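(* Let $G$ be an AH-algebra (the directed group of an e-ring $(R,E)$) with set of projections $P$, let $g\in G$, let $L:=L_g$ and $U:=U_g$ be the spectral lower and upper bounds of $g$, let $(p_\lambda)_{\lambda\in\mathbb R}$ be the spectral resolution of $g$, and let $(d_\lambda)_{\lambda\in\mathbb R}$ be the family of eigenprojections of $g$. Then for all $\lambda,\mu\in\mathbb R$: (i) $p_\lambda,\,d_\lambda\in P\cap CC(g)$ and $d_\lambda Cp_\lambda$. (ii) $p_\lambda g-\lambda p_\lambda\leq 0\leq (1-p_\lambda)g-\lambda(1-p_\lambda)$. (iii) If $\lambda\leq\mu$, then $p_\lambda\leq p_\mu$ and $p_\mu-p_\lambda=p_\mu\wedge(1-p_\lambda)$ (infimum in $P$). (iv) If $\lambda<\mu$, then $d_\lambda\leq p_\lambda\leq 1-d_\mu$. (v) If $\lambda>U$, then $p_\lambda=1$; and if $\lambda<U$, then $p_\lambda<1$. (vi) If $\lambda<L$, then $p_\lambda=0$; and if $L<\lambda$, then $0<p_\lambda$. (vii) $L=\sup\{\lambda\in\mathbb R: p_\lambda=0\}$ and $U=\inf\{\lambda\in\mathbb R: p_\lambda=1\}$. (viii) If $\lambda\leq\mu$ and $q\in P$ with $q\leq p_\mu-p_\lambda$, then $\lambda q\leq qgq\leq\mu q$.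
   Context: **e-rings.** An e-ring is a pair $(R,E)$ where $R$ is an associative ring with unity $1\neq 0$ and $E\subseteq R$ is a subset (elements called effects) such that $0,1\in E$; $e\in E\Rightarrow 1-e\in E$; and the set $E^{+}$ of all finite sums $e_1+\cdots+e_n$ with $e_i\in E$ satisfies, for all $a,b\in E^{+}$: (i) $-a\in E^{+}\Rightarrow a=0$; (ii) $1-a\in E^{+}\Rightarrow a\in E$; (iii) $ab=ba\Rightarrow ab\in E^{+}$; (iv) $aba\in E^{+}$; (v) $aba=0\Rightarrow ab=ba=0$; (vi) $(a-b)^2\in E^{+}$. The directed group of $(R,E)$ is $G:=E^{+}-E^{+}=\{a-b: a,b\in E^{+}\}$, a subgroup of the additive group of $R$, partially ordered by $g\leq h\Leftrightarrow h-g\in E^{+}$. The set of projections is $P:=\{p\in G: p=p^2\}$, partially ordered by restriction. Products of elements of $G$ are taken in $R$. **Commutants.** For $g,h\in G$, $gCh$ means $gh=hg$. For $A\subseteq G$, $C(A):=\{g\in G: gCa\ \forall a\in A\}$, $CC(A):=C(C(A))$, $CC(g):=CC(\{g\})$. **AH-algebra.** $G$ is an AH-algebra iff: (1) there is an effect $\frac12\in E$ with $\frac12+\frac12=1$; (2) quadratic annihilation (QA): for all $g,h\in G$, $gh^2g=0\Rightarrow gh=hg=0$; (3) commutative Vigier (CV) property: every ascending sequence $g_1\leq g_2\leq\cdots$ of pairwise commuting elements of $G$ that is bounded above in $G$ has a supremum $g$ in $G$, and $g\in CC(\{g_n:n\in\mathbb N\})$. An AH-algebra $G$ is always regarded as an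 archimedean partially ordered real vector space (it admits a compatible real vector space structure extending its ordered group structure, with $0\le\lambda$ and $0\le g$ implying $0\le\lambda g$; with the product $\frac12(gh+hg)$ it is a real Jordan algebra). In an AH-algebra, $P$ is an orthomodular lattice with orthocomplementation $p\mapsto 1-p$; $\wedge,\vee$ denote infimum and supremum in $P$. **Notation in an AH-algebra.** For $0\leq g\in G$, $g^{1/2}$ is the unique element of $G$ with $0\leq g^{1/2}$ and $(g^{1/2})^2=g$ (it exists); $|g|:=(g^2)^{1/2}$ and $g^{+}:=\frac12(|g|+g)$ for any $g\in G$. The carrier projection $g^{\mathrm o}$ of $g\in G$ is the unique projection in $P$ such that for all $h\in G$, $gh=0\Leftrightarrow g^{\mathrm o}h=0$ (it exists). **Spectral notions.** For $g\in G$: $L_g:=\sup\{\lambda\in\mathbb R:\lambda\cdot 1\leq g\}$ and $U_g:=\inf\{\lambda\in\mathbb R: g\leq\lambda\cdot 1\}$ are the spectral lower and upper bounds (both finite, with $L_g\le U_g$). For $\lambda\in\mathbb R$, $p_\lambda:=1-((g-\lambda\cdot 1)^{+})^{\mathrm o}\in P$ and $d_\lambda:=1-(g-\lambda\cdot 1)^{\mathrm o}\in P$; $(p_\lambda)_{\lambda\in\mathbb R}$ is the spectral resolution of $g$ and $d_\lambda$ is the $\lambda$-eigenprojection of $g$. *)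

(* Defs.v *)
From mathcomp Require Import all_boot all_order all_algebra.
From mathcomp Require Import all_classical all_reals.

Set Implicit Arguments.
Unset Strict Implicit.
Unset Printing Implicit Defensive.

Import Order.TTheory GRing.Theory Num.Theory.

Local Open Scope classical_set_scope.
Local Open Scope ring_scope.

Definition Eplus (R : nzRingType) (E : set R) : set R :=
  [set a | exists (n : nat) (e : 'I_n -> R),
             (forall i, E (e i)) /\ a = \sum_(i < n) e i].

Record is_ering (R : nzRingType) (E : set R) : Prop := IsERing {
  ering_0 : E 0;
  ering_1 : E 1;
  ering_compl : forall e, E e -> E (1 - e);
  ering_pointed : forall a, Eplus E a -> Eplus E (- a) -> a = 0;
  ering_effect : forall a, Eplus E a -> Eplus E (1 - a) -> E a;
  ering_mul : forall a b, Eplus E a -> Eplus E b ->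
    a * b = b * a -> Eplus E (a * b);
  ering_quad : forall a b, Eplus E a -> Eplus E b -> Eplus E (a * b * a);
  ering_quad0 : forall a b, Eplus E a -> Eplus E b ->
    a * b * a = 0 -> a * b = 0 /\ b * a = 0;
  ering_sqr : forall a b, Eplus E a -> Eplus E b -> Eplus E ((a - b) ^+ 2)
}.

Definition dgroup (R : nzRingType) (E : set R) : set R :=
  [set g | exists a b, [/\ Eplus E a, Eplus E b & g = a - b]].

(* For arguments in the directed group only. *)
Definition leG (R : nzRingType) (E : set R) (g h : R) : Prop :=
  Eplus E (h - g).

Definition ltG (R : nzRingType) (E : set R) (g h : R) : Prop :=
  leG E g h /\ g <> h.

Definition projG (R : nzRingType) (E : set R) : set R :=
  [set p | dgroup E p /\ p = p ^+ 2].

Definition is_meet_proj (R : nzRingType) (E : set R) (p q m : R) : Prop :=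
  [/\ projG E m, leG E m p, leG E m q
    & forall r, projG E r -> leG E r p -> leG E r q -> leG E r m].

Definition commutant (R : nzRingType) (E : set R) (A : set R) : set R :=
  [set g | dgroup E g /\ forall a, A a -> g * a = a * g].

Definition bicommutant (R : nzRingType) (E : set R) (A : set R) : set R :=
  commutant E (commutant E A).

Definition is_supG (R : nzRingType) (E : set R) (A : set R) (s : R) : Prop :=
  [/\ dgroup E s, (forall a, A a -> leG E a s)
    & forall h, dgroup E h -> (forall a, A a -> leG E a h) -> leG E s h].

Definition quadratic_annihilation (R : nzRingType) (E : set R) : Prop :=
  forall g h, dgroup E g -> dgroup E h ->
    g * h ^+ 2 * g = 0 -> g * h = 0 /\ h * g = 0.

Definition commutative_Vigier (R : nzRingType) (E : set R) : Prop :=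
  forall u : nat -> R,
    (forall n, dgroup E (u n)) ->
    (forall n, leG E (u n) (u n.+1)) ->
    (forall m n, u m * u n = u n * u m) ->
    (exists2 b, dgroup E b & forall n, leG E (u n) b) ->
    exists s, is_supG E (range u) s /\ bicommutant E (range u) s.

Record is_AH_algebra (R : nzRingType) (E : set R) : Prop := IsAHAlgebra {
  AH_ering : is_ering E;
  AH_half : exists2 c, E c & c + c = 1;
  AH_QA : quadratic_annihilation E;
  AH_CV : commutative_Vigier E
}.

(* A compatible real vector space structure on the directed group: only the
   values of [smul] on the directed group are constrained, since R itself need
   not be a real algebra.  The additive group structure is that of R. *)
Record is_scalar_mul (K : realType) (R : nzRingType) (E : set R)
    (smul : K -> R -> R) : Prop := IsScalarMul {
  smul_closed : forall x g, dgroup E g -> dgroup E (smul x g);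
  smul_1 : forall g, dgroup E g -> smul 1 g = g;
  smul_A : forall x y g, dgroup E g -> smul x (smul y g) = smul (x * y) g;
  smul_Dr : forall x g h, dgroup E g -> dgroup E h ->
    smul x (g + h) = smul x g + smul x h;
  smul_Dl : forall x y g, dgroup E g -> smul (x + y) g = smul x g + smul y g;
  smul_ge0 : forall x g, dgroup E g -> 0 <= x -> leG E 0 g ->
    leG E 0 (smul x g)
}.

(* [xget 0 S] is an element of S when there is one; in an AH-algebra the sets
   used in the next two definitions are singletons on the relevant domain. *)
Definition sqrtG (R : nzRingType) (E : set R) (g : R) : R :=
  xget 0 [set h | [/\ dgroup E h, leG E 0 h & h ^+ 2 = g]].

Definition carrier (R : nzRingType) (E : set R) (g : R) : R :=
  xget 0 [set p | projG E p /\
                  forall h, dgroup E h -> (g * h = 0 <-> p * h = 0)].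

Definition absG (R : nzRingType) (E : set R) (g : R) : R := sqrtG E (g ^+ 2).

Definition pos_part (K : realType) (R : nzRingType) (E : set R)
    (smul : K -> R -> R) (g : R) : R := smul 2^-1 (absG E g + g).

Definition spec_lower (K : realType) (R : nzRingType) (E : set R)
    (smul : K -> R -> R) (g : R) : K := sup [set x | leG E (smul x 1) g].

Definition spec_upper (K : realType) (R : nzRingType) (E : set R)
    (smul : K -> R -> R) (g : R) : K := inf [set x | leG E g (smul x 1)].

Definition spec_resolution (K : realType) (R : nzRingType) (E : set R)
    (smul : K -> R -> R) (g : R) (x : K) : R :=
  1 - carrier E (pos_part E smul (g - smul x 1)).

Definition eigenproj (K : realType) (R : nzRingType) (E : set R)
    (smul : K -> R -> R) (g : R) (x : K) : R :=
  1 - carrier E (g - smul x 1).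

(* Main.v *)
(* Bounded monotone sequences of commuting elements have infima, so three limits
   can be formed: [2^-n -> 0] gives the archimedean property; [(1 - a)^n], for
   [0 <= a <= 1], decreases to the complement of the carrier of [a]; an iteration
   decreases to the square root of [a].  All of them lie in the bicommutant of
   [a].  Hence [u = g - x] splits as [u^+ - u^-] with [u^+ u^- = 0], and the
   carrier [q] of [u^+] satisfies [q u >= 0 >= (1 - q) u].  As [p_x = 1 - q], the
   clauses follow by multiplying these two inequalities by projections commuting
   with [g], and comparing real multiples of a projection. *)
From Stdlib Require Ncring Ncring_tac.
Require Import Defs.
From mathcomp Require Import all_boot all_order all_algebra.
From mathcomp Require Import all_classical all_reals.

Set Implicit Arguments.
Unset Strict Implicit.
Unset Printing Implicit Defensive.

Import Order.TTheory GRing.Theory Num.Theory.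

Local Open Scope classical_set_scope.
Local Open Scope ring_scope.

(** * Automation for identities in a noncommutative ring *)

Section NoncommutativeRing.
Context (R : nzRingType).

(* These instances make [non_commutative_ring] available over [R]. *)
#[local] Instance ncring_ops :
  @Ncring.Ring_ops R 0 1 +%R *%R (fun x y => x - y) -%R (@eq R) := {}.

#[local] Instance ncring_ring :
  @Ncring.Ring R 0 1 +%R *%R (fun x y => x - y) -%R (@eq R) ncring_ops.
Proof.
constructor; cbn.
- by split=> [?|? ?|? ? ?] => [|->|-> ->].
- by move=> ? ? -> ? ? ->.
- by move=> ? ? -> ? ? ->.
- by move=> ? ? -> ? ? ->.
- by move=> ? ? ->.
- exact: add0r.
- exact: addrC.
- exact: addrA.
- exact: mul1r.
- exact: mulr1.
- exact: mulrA.
- exact: mulrDl.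
- by move=> x y z; exact: mulrDr.
- by [].
- exact: subrr.
Qed.

End NoncommutativeRing.

#[local] Existing Instance ncring_ops.
#[local] Existing Instance ncring_ring.

Ltac ncring := Ncring_tac.non_commutative_ring.

(** * Positive elements and projections *)

Section ERing.
Context (R : nzRingType) (E : set R) (hE : is_ering E).
Local Notation Pos := (Eplus E).
Local Notation G := (dgroup E).

Lemma Eplus0 : Pos 0.
Proof. by exists 0%N, (fun=> 0); split; [case|rewrite big_ord0]. Qed.

Lemma Eplus_effect e : E e -> Pos e.
Proof. by move=> Ee; exists 1%N, (fun=> e); rewrite big_ord1. Qed.

Lemma EplusD a b : Pos a -> Pos b -> Pos (a + b).
Proof.
move=> [m [e [Ee ->]]] [n [f [Ef ->]]].
exists (m + n)%N, (fun i : 'I_(m + n) =>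
  match fintype.split i with inl j => e j | inr k => f k end).
split=> [i|]; first by case: (fintype.split i).
by rewrite big_split_ord /=; congr (_ + _); apply: eq_bigr => i _;
  rewrite (unsplitK (inl _)) || rewrite (unsplitK (inr _)).
Qed.

Lemma Eplus1 : Pos 1.
Proof. exact/Eplus_effect/(ering_1 hE). Qed.

Lemma EplusMn a n : Pos a -> Pos (a *+ n).
Proof.
move=> a0; elim: n => [|n IH]; first exact: Eplus0.
by rewrite mulrS; exact: EplusD.
Qed.

Lemma Eplus_trans b a c : Pos (b - a) -> Pos (c - b) -> Pos (c - a).
Proof. move=> ba cb; rewrite (_ : c - a = b - a + (c - b)); last by ncring.
exact: EplusD.
Qed.

Lemma Eplus_anti a b : Pos (a - b) -> Pos (b - a) -> a = b.
Proof.
move=> ab ba; apply: subr0_eq; apply: (ering_pointed hE) => //.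
by rewrite opprB.
Qed.

Lemma Eplus_dgroup a : Pos a -> G a.
Proof.
by move=> a0; exists a, 0; split=> //; [exact: Eplus0|rewrite subr0].
Qed.

Lemma dgroup0 : G 0. Proof. exact/Eplus_dgroup/Eplus0. Qed.

Lemma dgroup1 : G 1. Proof. exact/Eplus_dgroup/Eplus1. Qed.

Lemma dgroupN a : G a -> G (- a).
Proof. by move=> [b [c [? ? ->]]]; exists c, b; split=> //; rewrite opprB. Qed.

Lemma dgroupD a b : G a -> G b -> G (a + b).
Proof.
move=> [a1 [a2 [? ? ->]]] [b1 [b2 [? ? ->]]]; exists (a1 + b1), (a2 + b2).
by split; [exact: EplusD|exact: EplusD|ncring].
Qed.

Lemma dgroupB a b : G a -> G b -> G (a - b).
Proof. by move=> ? ?; apply/dgroupD => //; exact: dgroupN. Qed.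

Lemma Eplus_sqr a : G a -> Pos (a * a).
Proof. by move=> [b [c [? ? ->]]]; rewrite -expr2; exact: (ering_sqr hE). Qed.

(** The number of effects in the sum serves as the bound, since each [1 - e i] is again an effect.
    Thus 1 is an order unit, the source of every boundedness statement below. *)
Lemma Eplus_order_unit a : Pos a -> exists n, Pos (n%:R - a).
Proof.
move=> [n [e [Ee ->]]]; exists n.
have -> : n%:R - \sum_(i < n) e i = \sum_(i < n) (1 - e i).
  by rewrite big_split /= sumr_const card_ord sumrN.
by exists n, (fun i => 1 - e i); split=> // i; exact: (ering_compl hE).
Qed.

Lemma dgroup_order_unit a : G a -> exists n, Pos (n%:R - a).
Proof.
move=> [b [c [/Eplus_order_unit[n bn] c0 ->]]]; exists n.
by rewrite opprB addrA addrAC; exact: EplusD.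
Qed.

Lemma EplusM a b : Pos a -> Pos b -> GRing.comm a b -> Pos (a * b).
Proof. exact: (ering_mul hE). Qed.

Lemma Eplus_eq0 a b : Pos a -> Pos b -> a + b = 0 -> a = 0.
Proof.
by move=> a0 b0 /eqP; rewrite addr_eq0 => /eqP e; apply: (ering_pointed hE);
  rewrite ?e ?opprK // -e.
Qed.

Lemma projG_dgroup p : projG E p -> G p. Proof. by case. Qed.

Lemma projG_mul p : projG E p -> p * p = p.
Proof. by rewrite -expr2 => -[]. Qed.

Lemma Eplus_projG p : projG E p -> Pos p.
Proof. by move=> hp; rewrite -(projG_mul hp); exact/Eplus_sqr/projG_dgroup. Qed.

Lemma projGC p : projG E p -> projG E (1 - p).
Proof.
move=> hp; split; first exact: dgroupB dgroup1 (projG_dgroup hp).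
rewrite expr2; have -> : (1 - p) * (1 - p) = 1 - p - p + p * p by ncring.
by rewrite projG_mul // subrK.
Qed.

Lemma projG_compress p a : projG E p -> Pos a -> Pos (p * a * p).
Proof. by move=> /Eplus_projG p0 a0; exact: (ering_quad hE). Qed.

(** The two equations make [q - p] idempotent, so it is its own square, and squares of the directed
    group are positive. *)
Lemma projG_le p q : projG E p -> projG E q -> p * q = p -> q * p = p ->
  Pos (q - p).
Proof.
move=> hp hq pq qp; rewrite (_ : q - p = (q - p) * (q - p)).
  exact/Eplus_sqr/dgroupB/projG_dgroup/hp/projG_dgroup.
rewrite mulrBl !mulrBr pq qp !projG_mul //.
by rewrite subrr subr0.
Qed.

(** Compressing [q - p] by [1 - q] leaves [- (1 - q) p (1 - q)], which is both positive and
    negative; the e-ring axiom on [a b a = 0] then removes one outer factor on either side. *)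
Lemma projG_le_mul p q : projG E p -> projG E q -> Pos (q - p) ->
  p * q = p /\ q * p = p.
Proof.
move=> hp hq pq; have hq' := projGC hq.
have := projG_compress hq' pq.
have -> : (1 - q) * (q - p) * (1 - q) =
          (q - q * q) * (1 - q) - (1 - q) * p * (1 - q) by ncring.
rewrite projG_mul // subrr mul0r sub0r.
move=> /(ering_pointed hE (projG_compress hq' (Eplus_projG hp))) z.
have [] := ering_quad0 hE (Eplus_projG hq') (Eplus_projG hp) z.
by rewrite mulrBl mulrBr mul1r mulr1 => /subr0_eq <- /subr0_eq <-.
Qed.

Lemma projGM p q : projG E p -> projG E q -> GRing.comm p q -> projG E (p * q).
Proof.
move=> hp hq pq; split.
  by apply/Eplus_dgroup/EplusM => //; exact: Eplus_projG.
by rewrite expr2 mulrA -(mulrA p) -pq mulrA projG_mul // -mulrA projG_mul.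
Qed.

(** A projection below both [p] and [q] is fixed by multiplication by each of them, hence by their
    product. *)
Lemma projG_meetM p q : projG E p -> projG E q -> GRing.comm p q ->
  is_meet_proj E p q (p * q).
Proof.
move=> hp hq pq; have hpq := projGM hp hq pq; split=> //.
- apply: projG_le => //; last by rewrite mulrA projG_mul.
  by rewrite pq -mulrA projG_mul.
- apply: projG_le => //; first by rewrite -mulrA projG_mul.
  by rewrite pq mulrA projG_mul.
- move=> r hr /(projG_le_mul hr hp)[rp pr] /(projG_le_mul hr hq)[rq qr].
  by apply: projG_le => //; rewrite ?mulrA ?rp // -mulrA qr.
Qed.

(** * The effect one half and dyadic scaling *)

Section Half.
Context (c : R) (Ec : E c) (c2 : c + c = 1).

(** Inserting [c + c = 1] on the right gives [c x = c x c + c x c = (c + c) x c = x c]. *)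
Lemma half_comm x : GRing.comm c x.
Proof.
rewrite /GRing.comm -[x in LHS]mulr1 -c2.
have -> : c * (x * (c + c)) = (c + c) * (x * c) by ncring.
by rewrite c2 mul1r.
Qed.

Lemma halfD x : c * x + c * x = x.
Proof. by rewrite -mulrDl c2 mul1r. Qed.

Lemma Eplus_half a : Pos a -> Pos (c * a).
Proof.
by move=> a0; apply: EplusM => //; [exact: Eplus_effect|exact: half_comm].
Qed.

Lemma dgroup_half a : G a -> G (c * a).
Proof.
by move=> [b [d [? ? ->]]]; rewrite mulrBr; apply: dgroupB;
  exact/Eplus_dgroup/Eplus_half.
Qed.

Lemma halfX_comm n x : GRing.comm (c ^+ n) x.
Proof. exact/commr_sym/commrX/commr_sym/half_comm. Qed.

Lemma halfXS n : c ^+ n.+1 + c ^+ n.+1 = c ^+ n.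
Proof. by rewrite exprS halfD. Qed.

Lemma Eplus_halfX n a : Pos a -> Pos (c ^+ n * a).
Proof.
by elim: n => [|n IH] a0; rewrite ?mul1r // exprS -mulrA; exact/Eplus_half/IH.
Qed.

Lemma dgroup_halfX n a : G a -> G (c ^+ n * a).
Proof.
by elim: n => [|n IH] a0; rewrite ?mul1r // exprS -mulrA; exact/dgroup_half/IH.
Qed.

Lemma halfXK n x : (c ^+ n * x) *+ (2 ^ n) = x.
Proof.
elim: n => [|n IH] in x *; first by rewrite mul1r.
by rewrite expnS mulrnA mulr2n exprS -!mulrA halfD IH.
Qed.

(** Polarization: a commuting product is half of [(a + b)^2 - a^2 - b^2]. *)
Lemma dgroupM a b : G a -> G b -> GRing.comm a b -> G (a * b).
Proof.
move=> Ga Gb ab.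
have -> : a * b = c * ((a + b) * (a + b) - a * a - b * b).
  have -> : (a + b) * (a + b) - a * a - b * b = a * b + b * a by ncring.
  by rewrite -ab mulrDr halfD.
apply: dgroup_half; apply: dgroupB; [apply: dgroupB|];
  by apply/Eplus_dgroup/Eplus_sqr => //; exact: dgroupD.
Qed.

(** * Infima, carriers and square roots *)

Section AHAlgebra.
Context (QA : quadratic_annihilation E).

(** Multiplying by [h] on the left gives [h g^2 h = 0], the form required by quadratic
    annihilation. *)
Lemma sqr_annih g h : G g -> G h -> g * g * h = 0 -> g * h = 0 /\ h * g = 0.
Proof.
move=> Gg Gh e; have [|hg gh] := QA Gh Gg; last by split.
by rewrite expr2 -mulrA e mulr0.
Qed.

Lemma annih_sym g h : G g -> G h -> g * h = 0 -> h * g = 0.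
Proof.
by move=> Gg Gh e; have [] := sqr_annih Gg Gh _; rewrite -?mulrA ?e ?mulr0.
Qed.

Lemma sqr_eq0 g : G g -> g * g = 0 -> g = 0.
Proof.
by move=> Gg e; have [] := sqr_annih Gg dgroup1; rewrite ?mulr1.
Qed.

(** Order dual of the conclusion of the Vigier property; the last clause is membership in the
    bicommutant of the range. *)
Definition is_comm_inf (u : nat -> R) (s : R) : Prop :=
  [/\ G s, forall n, Pos (u n - s),
      forall h, G h -> (forall n, Pos (u n - h)) -> Pos (s - h)
    & forall h, G h -> (forall n, GRing.comm h (u n)) -> GRing.comm h s].

(** If [h <= N (u n - s)] for all [n], then [s + 2^-N h] is still a lower bound because [N <= 2^N],
    so it is at most [s]. Scaling by [2^-N] replaces division by [N]: only halves are available
    here. *)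
Lemma is_comm_inf_squeeze u s N h : is_comm_inf u s -> G h ->
  (forall n, Pos ((u n - s) *+ N - h)) -> Pos (- h).
Proof.
move=> [Gs us inf_s _] Gh hu.
rewrite -(halfXK N (- h)) mulrN; apply: EplusMn.
rewrite -(_ : s - (s + c ^+ N * h) = - (c ^+ N * h)); last by ncring.
apply: inf_s => [|n]; first exact/dgroupD/dgroup_halfX.
rewrite opprD addrA -[X in X - _](halfXK N) -mulrnAr.
rewrite -mulrBr; apply: Eplus_halfX.
apply: Eplus_trans (hu n) _.
rewrite -mulrnBr ?(ltnW (ltn_expl _ _)) //.
exact/EplusMn/us.
Qed.

Context (CV : commutative_Vigier E).

Lemma comm_inf_ex u l : (forall n, G (u n)) ->
  (forall n, Pos (u n - u n.+1)) -> (forall m n, GRing.comm (u m) (u n)) ->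
  G l -> (forall n, Pos (u n - l)) -> exists s, is_comm_inf u s.
Proof.
move=> Gu du cu Gl lu.
have [s [[Gs us sup_s] [_ bs]]] : exists s,
    is_supG E (range (fun n => - u n)) s /\
    bicommutant E (range (fun n => - u n)) s.
  apply: CV.
- by move=> n; exact: dgroupN.
- by move=> n; rewrite /leG opprK addrC.
- by move=> m n; rewrite !mulNr !mulrN; congr (- - _); exact: cu.
- exists (- l) => [|n]; first exact: dgroupN.
  by rewrite /leG opprK addrC.
exists (- s); split=> [|n|h Gh hu|h Gh hu].
- exact: dgroupN.
- by have := us (- u n) (imageT _ n); rewrite /leG !opprK addrC.
- have := sup_s (- h) (dgroupN Gh); rewrite /leG.
  rewrite [- h - s]addrC; apply=> _ [n _ <-].
  by rewrite opprK addrC.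
- apply: commrN; apply: commr_sym; apply: bs; split=> // _ [n _ <-].
  exact: commrN.
Qed.

Lemma halfX_inf : is_comm_inf (fun n => c ^+ n) 0.
Proof.
have c0 n : Pos (c ^+ n) by rewrite -[c ^+ n]mulr1; exact/Eplus_halfX/Eplus1.
have [|||||s sP] := @comm_inf_ex (fun n => c ^+ n) 0.
- by move=> n; exact: Eplus_dgroup.
- by move=> n; rewrite -halfXS addrK.
- by move=> m n; exact: halfX_comm.
- exact: dgroup0.
- by move=> n; rewrite subr0.
suff s0 : s = 0 by rewrite s0 in sP.
have [Gs us inf_s _] := sP.
apply: (ering_pointed hE).
  by rewrite -[s]subr0; apply: inf_s => [|n]; [exact: dgroup0|rewrite subr0].
(* The double [s + s] is again a lower bound, since [c ^+ n] is twice [c ^+ n.+1]; hence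
   [s + s <= s]. *)
rewrite (_ : - s = s - (s + s)); last by ncring.
apply: inf_s => [|n]; first exact: dgroupD.
by rewrite -halfXS opprD addrACA; exact: EplusD.
Qed.

Lemma archimedean N h : G h -> (forall n, Pos (c ^+ n *+ N - h)) -> Pos (- h).
Proof.
move=> Gh hn; apply: (is_comm_inf_squeeze halfX_inf Gh (N := N)) => n.
by rewrite subr0.
Qed.


(* [p = 1 - s], where [s] is the infimum of the powers of [1 - a]. *)
Lemma carrier_ex_unit a : Pos a -> Pos (1 - a) -> exists p, [/\ projG E p,
  forall h, G h -> (a * h = 0 <-> p * h = 0)
  & forall h, G h -> GRing.comm h a -> GRing.comm h p].
Proof.
move=> a0; have [x xE aE] : exists2 x, 1 - a = x & a = 1 - x.
  by exists (1 - a) => //; rewrite opprB addrC subrK.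
rewrite xE => x0; have Ga := Eplus_dgroup a0; have Gx := Eplus_dgroup x0.
have ax : GRing.comm a x by rewrite -xE; apply/commrB => //; exact: commr1.
have xn0 n : Pos (x ^+ n).
  elim: n => [|n IH]; first exact: Eplus1.
  by rewrite exprS; apply: EplusM => //; exact: commrX.
have commx h : GRing.comm h a -> GRing.comm h x.
  by move=> ha; rewrite -xE; apply: commrB => //; exact: commr1.
have stepE n : x ^+ n - x ^+ n.+1 = a * x ^+ n.
  by rewrite exprS aE mulrBl mul1r.
have [|||||s sP] := @comm_inf_ex (fun n => x ^+ n) 0.
- by move=> n; exact: Eplus_dgroup.
- by move=> n; rewrite stepE; apply: EplusM => //; exact: commrX.
- by move=> m n; apply: commrX; apply: commr_sym; exact: commrX.
- exact: dgroup0.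
- by move=> n; rewrite subr0.
have [Gs us inf_s cs] := sP.
have s0 : Pos s.
  by rewrite -[s]subr0; apply: inf_s => [|n]; [exact: dgroup0|rewrite subr0].
have comms h : G h -> GRing.comm h x -> GRing.comm h s.
  by move=> Gh hx; apply: cs => // n; exact: commrX.
have as_ : GRing.comm a s by exact: comms.
(* The difference [s - x s = a s] is positive and at most [x ^+ n - s] for every [n], so it
   vanishes. *)
have xs : x * s = s.
  apply/esym/Eplus_anti.
    by rewrite -[X in X - _]mul1r -mulrBl -aE; exact: EplusM.
  rewrite -opprB; apply: (is_comm_inf_squeeze sP (N := 1)).
    by rewrite -[X in X - _]mul1r -mulrBl -aE; exact: dgroupM.
  move=> n; rewrite mulr1n.
  rewrite (_ : _ - _ = x ^+ n.+1 - s + a * (x ^+ n - s)).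
    apply: EplusD => //; apply: EplusM => //.
    by apply: commrB => //; exact: commrX.
  by rewrite exprS aE; ncring.
have sx n : s * x ^+ n = s.
  elim: n => [|n IH]; first by rewrite mulr1.
  by rewrite exprSr mulrA IH -(comms x Gx (commr_refl x)).
have s1 : Pos (1 - s) by exact: (us 0%N).
(* Since [s * x ^+ n = s], the positive product [(1 - s) (x ^+ n - s)] bounds [s - s^2] by
   [x ^+ n - s]. *)
have ss : s * s = s.
  apply/Eplus_anti; last first.
    rewrite -[X in X - _]mulr1 -mulrBr; apply: EplusM => //.
    by apply: commrB => //; exact: commr1.
  rewrite -opprB; apply: (is_comm_inf_squeeze sP (N := 1)).
    by apply: dgroupB => //; exact: dgroupM.
  move=> n; rewrite mulr1n.
  rewrite (_ : _ - _ = (1 - s) * (x ^+ n - s)).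
    apply: EplusM => //; apply: commrB.
      by apply: commrX; apply/commr_sym/commrB; [exact: commr1|exact: comms].
    by apply/commr_sym/commrB; [exact: commr1|].
  rewrite (_ : (1 - s) * (x ^+ n - s) = x ^+ n - s - (s * x ^+ n - s * s));
    last by ncring.
  by rewrite sx.
have ps : projG E s by split=> //; rewrite expr2.
exists (1 - s); split=> [|h Gh|h Gh ha]; first exact: projGC; last first.
  by apply: commrB; [exact: commr1|exact/comms/commx].
split=> [ah|]; last first.
  rewrite mulrBl mul1r => /subr0_eq ->.
  by rewrite mulrA aE (mulrBl s) mul1r xs subrr mul0r.
have ha := annih_sym Ga Gh ah.
have hx : GRing.comm h x by apply: commx; rewrite /GRing.comm ah.
have hs := comms h Gh hx.
have hxn n : h * x ^+ n = h.
  elim: n => [|n IH]; first by rewrite mulr1.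
  by rewrite exprSr mulrA IH -xE mulrBr mulr1 ha subr0.
have h0 := Eplus_sqr Gh.
have [N hN] := Eplus_order_unit h0.
have hhs : GRing.comm (h * h) s.
  by apply/commr_sym/commrM; exact: commr_sym.
(* As [h] is fixed by every power of [x], [h^2 (1 - s) = h^2 (x ^+ n - s) <= N (x ^+ n - s)], which
   is squeezed to zero. *)
have hh0 : h * h * (1 - s) = 0.
  apply: (ering_pointed hE).
    by apply: EplusM => //; apply: commrB => //; exact: commr1.
  apply: (is_comm_inf_squeeze sP (N := N)).
    apply: dgroupM => //; [exact: Eplus_dgroup|exact: Eplus_dgroup|].
    by apply: commrB => //; exact: commr1.
  move=> n.
  rewrite (_ : h * h * (1 - s) = h * h * (x ^+ n - s)).
    rewrite -mulr_natl -mulrBl; apply: EplusM => //.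
    apply: commrB; apply/commr_sym/commrB; rewrite -?/(GRing.comm _ _);
      try by [exact: commr_nat|exact: commr_sym].
    by apply: commrM; apply/commr_sym/commrX.
  by rewrite !mulrBr mulr1 -[in RHS](mulrA h h (x ^+ n)) hxn.
have G1s := projG_dgroup (projGC ps).
by have [] := sqr_annih Gh G1s hh0.
Qed.

(** The exponent is even so that a square root of the rescaled element can be scaled back by
    [2 ^ n]. *)
Lemma dgroup_rescale a : Pos a -> exists n, Pos (1 - c ^+ (n + n) * a).
Proof.
move=> /Eplus_order_unit[n na]; exists n.
rewrite -[X in X - _](halfXK (n + n)) mulr1 -mulr_natr -mulrBr.
apply: Eplus_halfX; apply: Eplus_trans na _; rewrite -natrB.
  exact/EplusMn/Eplus1.
exact: leq_trans (leq_addl n n) (ltnW (ltn_expl _ _)).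
Qed.

(** Squaring makes [g] positive and keeps its annihilator, by [sqr_annih]; rescaling then brings the
    square below 1. *)
Lemma carrier_ex g : G g -> exists p, [/\ projG E p,
  forall h, G h -> (g * h = 0 <-> p * h = 0)
  & forall h, G h -> GRing.comm h g -> GRing.comm h p].
Proof.
move=> Gg; have g0 := Eplus_sqr Gg.
have [n n1] := dgroup_rescale g0.
have [p [pp ann cp]] := carrier_ex_unit (Eplus_halfX (n + n) g0) n1.
exists p; split=> // h Gh; last first.
  move=> hg; apply: cp => //; apply/commrM; last exact: commrM.
  exact/commr_sym/halfX_comm.
rewrite -ann //; split=> [gh|]; first by rewrite -!mulrA gh !mulr0.
move=> /(congr1 (fun y => y *+ 2 ^ (n + n))).
rewrite -mulrA halfXK mul0rn => ggh.
by have [] := sqr_annih Gg Gh ggh.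
Qed.

(** Testing on [1 - q] and [1 - p] gives [p q = p] and [q p = q]; symmetry of annihilation turns the
    first into [q p = p]. *)
Lemma carrier_uniq p q : projG E p -> projG E q ->
  (forall h, G h -> (p * h = 0 <-> q * h = 0)) -> p = q.
Proof.
move=> hp hq pq.
have ann r : projG E r -> r * (1 - r) = 0.
  by move=> hr; rewrite mulrBr mulr1 projG_mul // subrr.
have G1 r : projG E r -> G (1 - r).
  by move=> hr; exact/projG_dgroup/projGC.
have pq0 : p * (1 - q) = 0 by apply/pq; [exact: G1|exact: ann].
have qp0 : q * (1 - p) = 0 by apply/pq; [exact: G1|exact: ann].
have := annih_sym (projG_dgroup hp) (G1 _ hq) pq0.
move: qp0; rewrite mulrBr mulr1 mulrBl mul1r => /subr0_eq <- /subr0_eq.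
by move=> <-.
Qed.

Lemma carrierP g : G g -> [/\ projG E (carrier E g),
  forall h, G h -> (g * h = 0 <-> carrier E g * h = 0)
  & forall h, G h -> GRing.comm h g -> GRing.comm h (carrier E g)].
Proof.
move=> Gg; have [p [hp ann cp]] := carrier_ex Gg.
have [hq annq] : [set p | projG E p /\
    forall h, G h -> (g * h = 0 <-> p * h = 0)] (carrier E g).
  by apply: xgetPex; exists p.
suff <- : p = carrier E g by [].
by apply: carrier_uniq => // h Gh; rewrite -ann // annq.
Qed.

(* [r] is the infimum of the decreasing iterates of [r |-> r + (a - r^2) / 2]
   started at [1]. *)
Lemma sqrt_ex_unit a : Pos a -> Pos (1 - a) -> exists r,
  [/\ Pos r, r * r = a & forall h, G h -> GRing.comm h a -> GRing.comm h r].
Proof.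
move=> a0 a1; have Ga := Eplus_dgroup a0.
pose r := fix r n := if n is m.+1 then r m + c * (a - r m * r m) else 1.
have rS n : r n.+1 = r n + c * (a - r n * r n) by [].
have comr h n : GRing.comm h a -> GRing.comm h (r n).
  move=> ha; elim: n => [|n IH]; first exact: commr1.
  apply: commrD => //; apply: commrM; first exact/commr_sym/half_comm.
  by apply: commrB => //; exact: commrM.
(* The iterates stay in [[0, 1]] with square at least [a]. With [w = r n ^ 2 - a], the next excess
   is [w (1 - r n) + (c w)^2], again positive. *)
have inv n : [/\ Pos (r n), Pos (1 - r n) & Pos (r n * r n - a)].
  elim: n => [|n [r0 r1 ra]].
    by rewrite /= mulr1 subrr; split=> //; [exact: Eplus1|exact: Eplus0].
  have rr : GRing.comm a (r n) by exact: comr.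
  set w := r n * r n - a in ra.
  have rw : GRing.comm (r n) w.
    by apply: commrB; [exact: commrM|exact: commr_sym].
  have rE : r n.+1 = r n - c * w by rewrite rS /w; ncring.
  split.
  - rewrite rS -[X in X + _]halfD.
    rewrite (_ : _ + _ + _ = c * (r n + r n * (1 - r n) + a)); last by ncring.
    apply: Eplus_half => //; apply: EplusD => //; apply: EplusD => //.
    by apply: EplusM => //; apply: commrB; [exact: commr1|].
  - rewrite rE (_ : _ - _ = 1 - r n + c * w); last by ncring.
    by apply: EplusD => //; exact: Eplus_half.
  - have crw : r n * (c * w) = c * (w * r n).
      by rewrite mulrA -(half_comm (r n)) -mulrA rw.
    have -> : r n.+1 * r n.+1 - a = w * (1 - r n) + c * w * (c * w).
      transitivity (w - (r n * (c * w) + c * (w * r n)) + c * w * (c * w)).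
        by rewrite rE /w; ncring.
      by rewrite crw halfD; ncring.
    apply: EplusD.
      apply: EplusM => //; apply: commrB; [exact: commr1|exact: commr_sym].
    by apply/Eplus_sqr/dgroup_half => //; exact: Eplus_dgroup.
have rdiff n : r n - r n.+1 = c * (r n * r n - a) by rewrite rS; ncring.
have [|||||s sP] := @comm_inf_ex r 0.
- by move=> n; have [/Eplus_dgroup] := inv n.
- by move=> n; rewrite rdiff; apply: Eplus_half => //; have [] := inv n.
- by move=> m n; apply/comr/commr_sym/comr.
- exact: dgroup0.
- by move=> n; rewrite subr0; have [] := inv n.
have [Gs us inf_s cs] := sP.
have s0 : Pos s.
  rewrite -[s]subr0; apply: inf_s => [|n]; first exact: dgroup0.
  by rewrite subr0; have [] := inv n.
have comms h : G h -> GRing.comm h a -> GRing.comm h s.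
  by move=> Gh ha; apply: cs => // n; exact: comr.
have sr n : GRing.comm s (r n) by apply/comr/commr_sym/comms.
have sqE n : r n * r n - s * s = (r n - s) * (r n + s).
  transitivity ((r n - s) * (r n + s) - (r n * s - s * r n)); first by ncring.
  by rewrite (sr n) subrr subr0.
have Gss : G (s * s - a) by apply: dgroupB => //; exact: dgroupM.
(* Both [a - s^2] and [s^2 - a] are at most [2 (r n - s)]: the first because [r n] and [s] lie below
   1, the second because [r n ^ 2 - a] is twice the decrement [r n - r n.+1]. *)
exists s; split=> //; apply/Eplus_anti; rewrite -opprB.
  apply: (is_comm_inf_squeeze sP (N := 2)) => [|n].
    by rewrite -opprB; exact: dgroupN.
  have [r0 r1 ra] := inv n.
  rewrite (_ : _ - _ = (r n - s) * (1 - r n + (1 - s)) + (r n * r n - a)).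
    apply: EplusD => //; apply: EplusM => //.
      apply: EplusD => //; apply: Eplus_trans r1; first exact: us.
    apply: commrD; apply: commrB; try exact: commr1; apply: commr_sym;
      apply: commrB => //; exact: commr_sym.
  transitivity ((r n - s) *+ 2 - (r n * r n - s * s) + (r n * r n - a)).
    by rewrite mulr2n; ncring.
  by rewrite sqE mulr2n; ncring.
apply: (is_comm_inf_squeeze sP (N := 2)) => // n; have [r0 r1 ra] := inv n.
rewrite (_ : _ - _ = (r n.+1 - s) *+ 2 + (r n * r n - s * s)).
  apply: EplusD; first exact: EplusMn.
  rewrite sqE; apply: EplusM; [exact: us|exact: EplusD|].
  apply: commrD; apply: commr_sym; apply: commrB => //; exact: commr_sym.
have e : (r n - r n.+1) *+ 2 = r n * r n - a.
  by rewrite rdiff mulr2n halfD.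
transitivity ((r n.+1 - s) *+ 2 + (r n - r n.+1) *+ 2 - (s * s - a)).
  by rewrite !mulr2n; ncring.
by rewrite e; ncring.
Qed.

Lemma sqrt_ex a : Pos a -> exists r,
  [/\ Pos r, r * r = a & forall h, G h -> GRing.comm h a -> GRing.comm h r].
Proof.
move=> a0; have [n n1] := dgroup_rescale a0.
have [r [r0 rr cr]] := sqrt_ex_unit (Eplus_halfX (n + n) a0) n1.
exists (r *+ 2 ^ n); split=> [||h Gh ha]; first exact: EplusMn.
  by rewrite mulrnAl mulrnAr -mulrnA -expnD rr halfXK.
apply: commrMn; apply: cr => //; apply: commrM => //.
exact/commr_sym/halfX_comm.
Qed.

(** With [d = r - s], the positive elements [d^2 r] and [d^2 s] add up to [d (r^2 - s^2) = 0], so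
    both vanish and [d^3 = 0]; then [d^4 = 0], and two applications of [sqr_eq0] finish. *)
Lemma sqrt_uniq r s :
  Pos r -> Pos s -> GRing.comm r s -> r * r = s * s -> r = s.
Proof.
move=> r0 s0 rs e; apply: subr0_eq; set d := r - s.
have Gd : G d by apply: dgroupB; exact: Eplus_dgroup.
have dd0 := Eplus_sqr Gd.
have dd_comm t : GRing.comm t d -> GRing.comm (d * d) t.
  by move=> td; apply/commr_sym/commrM.
have dr : Pos (d * d * r).
  by apply: EplusM => //; apply: dd_comm; apply: commrB.
have ds : Pos (d * d * s).
  by apply: EplusM => //; apply: dd_comm; apply: commrB => //; exact: commr_sym.
have sum0 : d * d * r + d * d * s = 0.
  transitivity (d * (r * r - s * s + (r * s - s * r))).
    by rewrite /d; ncring.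
  by rewrite e rs !subrr addr0 mulr0.
have dr0 := Eplus_eq0 dr ds sum0.
have ds0 : d * d * s = 0 by move: sum0; rewrite dr0 add0r.
have ddd : d * d * d = 0 by rewrite {3}/d mulrBr dr0 ds0 subrr.
apply: sqr_eq0 => //; apply: sqr_eq0; first exact: Eplus_dgroup.
by rewrite mulrA ddd mul0r.
Qed.

Lemma sqrtGP a : Pos a -> [/\ Pos (sqrtG E a), sqrtG E a * sqrtG E a = a
  & forall h, G h -> GRing.comm h a -> GRing.comm h (sqrtG E a)].
Proof.
move=> a0; have [r [r0 rr cr]] := sqrt_ex a0.
have [Gs s0 ss] : [set h | [/\ G h, leG E 0 h & h ^+ 2 = a]] (sqrtG E a).
  apply: xgetPex; exists r; split; first exact: Eplus_dgroup.
    by rewrite /leG subr0.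
  by rewrite expr2.
rewrite /leG subr0 in s0; rewrite expr2 in ss.
(* The chosen root commutes with its square [a], hence with [r], so uniqueness applies and transfers
   the commutation property of [r]. *)
have sr : GRing.comm (sqrtG E a) r.
  apply: cr => //; rewrite -{2}ss; apply: commrM; exact: commr_refl.
by rewrite (sqrt_uniq s0 r0 sr) // ss.
Qed.

(** * Absolute value and positive part *)

Lemma absGP g : G g -> [/\ Pos (absG E g), absG E g * absG E g = g * g
  & forall h, G h -> GRing.comm h g -> GRing.comm h (absG E g)].
Proof.
move=> Gg; have [a0 aa ca] := sqrtGP (Eplus_sqr Gg).
rewrite /absG expr2; split=> // h Gh hg; apply: ca => //; exact: commrM.
Qed.

(* Positivity of [u^+] is not known beforehand: it holds because
   [u^+ = q |u|] is a product of commuting positive elements, [q] being the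
   carrier of [u^+], which annihilates [u^-]. *)
Lemma carrier_pos_partP u : G u ->
  let q := carrier E (c * (absG E u + u)) in
  [/\ projG E q, forall h, G h -> GRing.comm h u -> GRing.comm h q,
      Pos (q * u), Pos (- ((1 - q) * u))
    & forall h, G h -> q * u * h = 0 -> q * h = 0].
Proof.
move=> Gu q; have [a0 aa ca] := absGP Gu.
set a := absG E u in a0 aa ca q *; have Ga := Eplus_dgroup a0.
pose v := c * (a + u); pose w := c * (a - u).
have Gv : G v by apply: dgroup_half => //; exact: dgroupD.
have Gw : G w by apply: dgroup_half => //; exact: dgroupB.
have [hq ann cq] := carrierP Gv; rewrite -/q in hq ann cq.
(* [v] and [w] are the positive and negative parts; since [a] commutes with [u], their product is a
   quarter of [a^2 - u^2 = 0]. *)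
have vw : v * w = 0.
  rewrite /v /w mulrA -(half_comm (c * _)) -!mulrA.
  rewrite (_ : (a + u) * (a - u) = a * a - u * u - (a * u - u * a));
    last by ncring.
  by rewrite aa -(ca u) // !subrr !mulr0.
have vDw : v + w = a by rewrite /v /w -mulrDr addrACA subrr addr0 mulrDr halfD.
have vBw : v - w = u.
  rewrite -[RHS]halfD /v /w; ncring.
have qw : q * w = 0 by apply/ann.
have Gq1 := projG_dgroup (projGC hq).
have qv : q * v = v.
  have /(annih_sym Gv Gq1) : v * (1 - q) = 0.
    by apply/ann => //; rewrite mulrBr mulr1 (projG_mul hq) subrr.
  by rewrite mulrBl mul1r => /subr0_eq.
have comq h : G h -> GRing.comm h u -> GRing.comm h q.
  move=> Gh hu; apply: cq => //; apply: commrM; first exact/commr_sym/half_comm.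
  by apply: commrD => //; exact: ca.
have qu : q * u = v by rewrite -vBw mulrBr qv qw subr0.
have aq : GRing.comm a q by apply/comq/commr_sym/ca.
split=> //.
- have -> : q * u = q * a by rewrite qu -vDw mulrDr qv qw addr0.
  by apply: EplusM => //; exact: Eplus_projG.
(* Here [- (1 - q) u] is [w], and [w = (1 - q) a] because [q] fixes [v] and kills [w]. *)
- rewrite mulrBl mul1r qu -vBw opprB opprB addrCA subrr addr0.
  rewrite (_ : w = (1 - q) * a).
    apply: EplusM => //; first exact/Eplus_projG/projGC.
    by apply/commr_sym/commrB => //; exact: commr1.
  by rewrite -vDw mulrBl mul1r mulrDr qv qw addr0 addrC addKr.
- by move=> h Gh; rewrite qu => /ann; apply.
Qed.

(** * Real scalars *)

Section ScalarMultiplication.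
Context (K : realType) (smul : K -> R -> R) (hs : is_scalar_mul E smul).

Lemma smul0l g : G g -> smul 0 g = 0.
Proof.
move=> Gg; apply: (addrI (smul 0 g)).
by rewrite -(smul_Dl hs) // !addr0.
Qed.

Lemma smulNl x g : G g -> smul (- x) g = - smul x g.
Proof.
move=> Gg; apply: (addrI (smul x g)).
by rewrite -(smul_Dl hs) // !subrr smul0l.
Qed.

Lemma smulBl x y g : G g -> smul (x - y) g = smul x g - smul y g.
Proof. by move=> Gg; rewrite (smul_Dl hs) // smulNl. Qed.

Lemma smulBr x g h : G g -> G h -> smul x (g - h) = smul x g - smul x h.
Proof.
move=> Gg Gh; apply: (addIr (smul x h)).
by rewrite -(smul_Dr hs) ?subrK //; exact: dgroupB.
Qed.

Lemma Eplus_smul x a : 0 <= x -> Pos a -> Pos (smul x a).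
Proof.
move=> x0 a0; have := smul_ge0 hs (Eplus_dgroup a0) x0.
by rewrite /leG !subr0; exact.
Qed.

Lemma smul_le x y a : x <= y -> Pos a -> Pos (smul y a - smul x a).
Proof.
move=> xy a0; rewrite -smulBl; last exact: Eplus_dgroup.
by apply: Eplus_smul; rewrite ?subr_ge0.
Qed.

Lemma smul_half g : G g -> smul 2^-1 g = c * g.
Proof.
move=> Gg.
have {2}<- : smul 2^-1 g + smul 2^-1 g = g.
  by rewrite -(smul_Dl hs) // -[2^-1 in LHS]mul1r -splitr (smul_1 hs).
by rewrite mulrDr halfD.
Qed.

Lemma smul_dyadic n m g : G g -> smul (2^-1 ^+ n *+ m) g = c ^+ n * g *+ m.
Proof.
move=> Gg; have -> : c ^+ n * g = smul (2^-1 ^+ n) g.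
  elim: n => [|n IH]; first by rewrite mul1r (smul_1 hs).
  rewrite !exprS -(smul_A hs) // -mulrA IH smul_half //.
  exact: (smul_closed hs).
move: (2^-1 ^+ n) => y.
by elim: m => [|m IH]; rewrite ?mulr0n ?smul0l // !mulrS (smul_Dl hs) // IH.
Qed.

(** [m / 2^n] is the dyadic number of level [n] just below [x]. Dyadic multiples can be written with
    the ring element [c], which ties the abstract scalars to the product of [R]. *)
Lemma smul_dyadic_approx n x a : 0 <= x -> Pos a ->
  let m := Num.truncn (x * 2 ^+ n) in
  Pos (smul x a - c ^+ n * a *+ m) /\
  Pos (c ^+ n * a - (smul x a - c ^+ n * a *+ m)).
Proof.
move=> x0 a0 m; have Ga := Eplus_dgroup a0.
have k0 : (0 : K) < 2 ^+ n by rewrite exprn_gt0.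
have /andP[lom him] : m%:R <= x * 2 ^+ n < m.+1%:R.
  by apply: truncn_itv; rewrite mulr_ge0 // ltW.
have scale k : k%:R / 2 ^+ n = 2^-1 ^+ n *+ k :> K by rewrite exprVn mulr_natl.
split; rewrite -smul_dyadic //.
  by apply: smul_le => //; rewrite -scale ler_pdivrMr.
rewrite opprB addrA [c ^+ n * a + _]addrC.
rewrite -[c ^+ n * a]mulr1n -smul_dyadic // -(smul_Dl hs) // -mulrnDr addn1.
by apply: smul_le => //; rewrite -scale ler_pdivlMr // ltW.
Qed.

(* The axioms of a scalar multiplication say nothing about the product of [R]:
   that [smul x 1] is central comes from its being the supremum of dyadic
   multiples of [1]. *)
Lemma smul1_central x h : G h -> GRing.comm h (smul x 1).
Proof.
move=> Gh; wlog x0 : x / 0 <= x.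
  move=> IH; have [/IH//|/ltW x0] := leP 0 x.
  rewrite -[x]opprK smulNl; last exact: dgroup1.
  by apply/commrN/IH; rewrite oppr_ge0.
have app n := smul_dyadic_approx n x0 Eplus1.
pose m n := Num.truncn (x * 2 ^+ n).
have G1 := dgroup1; have Gx := smul_closed hs x G1.
have Gcn n : G (c ^+ n) by rewrite -[c ^+ n]mulr1; exact: dgroup_halfX.
(* Refining the level does not lower the dyadic approximation, so the negated sequence below is
   decreasing. *)
have m2 n : (m n * 2 <= m n.+1)%N.
  rewrite /m truncn_ge_nat; last by rewrite mulr_ge0 // exprn_ge0.
  rewrite natrM exprSr mulrA ler_pM2r //.
  by have /andP[] := truncn_itv (mulr_ge0 x0 (exprn_ge0 n (ler0n K 2))).
have [|||||s sP] := @comm_inf_ex (fun n => - (c ^+ n *+ m n)) (- smul x 1).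
- move=> n; apply: dgroupN; rewrite -[_ *+ _]mulr_natr; apply: dgroupM => //.
    exact/Eplus_dgroup/EplusMn/Eplus1.
  exact: halfX_comm.
- move=> n; rewrite opprK addrC -(halfXS n) -mulr2n -mulrnA mulnC.
  rewrite -mulrnBr //; apply: EplusMn.
  by rewrite -[c ^+ _]mulr1; exact/Eplus_halfX/Eplus1.
- move=> k n; apply/commrN/commr_sym/commrN/commrMn/commr_sym/commrMn.
  exact: halfX_comm.
- exact: dgroupN.
- by move=> n; have [] := app n; rewrite mulr1 opprK addrC.
have [Gs us inf_s cs] := sP.
suff -> : smul x 1 = - s.
  by apply/commrN/cs => // n; apply/commrN/commrMn/commr_sym/halfX_comm.
apply: oppr_inj; rewrite opprK; apply/esym/Eplus_anti.
  apply: inf_s => [|n]; first exact: dgroupN.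
  by have [] := app n; rewrite mulr1 opprK addrC.
rewrite -opprB; apply: (archimedean (N := 1)); first exact/dgroupB/dgroupN.
move=> n; rewrite mulr1n; have [_] := app n; rewrite mulr1 => hn.
rewrite (_ : _ - _ = c ^+ n - (smul x 1 - c ^+ n *+ m n) +
                     (- (c ^+ n *+ m n) - s)); last by ncring.
exact: EplusD.
Qed.

(** For positive [x] and [g], both sides exceed the same dyadic multiple of [g] by at most
    [2^-n g <= 2^-n N], so the archimedean property identifies them; signs and differences give the
    general case. *)
Lemma smulE x g : G g -> smul x g = smul x 1 * g.
Proof.
move=> Gg; wlog x0 : x / 0 <= x.
  move=> IH; have [/IH//|/ltW x0] := leP 0 x; apply: oppr_inj.
  rewrite -mulNr -!smulNl //; last exact: dgroup1.
  by apply: IH; rewrite oppr_ge0.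
wlog g0 : g Gg / Pos g.
  move=> IH; have [a [b [a0 b0 ->]]] := Gg.
  by rewrite smulBr ?mulrBr -?IH //; exact: Eplus_dgroup.
have Gx := smul_closed hs x dgroup1.
have [N hN] := Eplus_order_unit g0.
have Gd : G (smul x g - smul x 1 * g).
  apply: dgroupB; first exact: (smul_closed hs).
  by apply: dgroupM => //; exact/commr_sym/smul1_central.
have bound n : exists y,
    [/\ Pos (smul x g - y), Pos (c ^+ n * g - (smul x g - y)),
        Pos (smul x 1 * g - y) & Pos (c ^+ n * g - (smul x 1 * g - y))].
  exists (c ^+ n * g *+ Num.truncn (x * 2 ^+ n)).
  have [? ?] := smul_dyadic_approx n x0 g0.
  have [lo hi] := smul_dyadic_approx n x0 Eplus1.
  rewrite mulr1 in lo hi; have cg := halfX_comm n g.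
  have xg : GRing.comm g (smul x 1) by exact: smul1_central.
  split=> //; rewrite -mulrnAl -!mulrBl; apply: EplusM => //; apply: commr_sym;
    do ?[apply: commrB => //]; do ?[apply: commrMn]; exact: commr_sym.
have cgN n : Pos (c ^+ n *+ N - c ^+ n * g).
  by rewrite -mulr_natr -mulrBr; exact: Eplus_halfX.
apply: Eplus_anti; rewrite -opprB; apply: (archimedean (N := N)) => //.
- by rewrite -opprB; exact: dgroupN.
- move=> n; have [y [y1 y2 y3 y4]] := bound n.
  have := EplusD y1 (EplusD y4 (cgN n)).
  by congr Pos; ncring.
- move=> n; have [y [y1 y2 y3 y4]] := bound n.
  have := EplusD y2 (EplusD y3 (cgN n)).
  by congr Pos; ncring.
Qed.

Lemma smul1M x y : smul x 1 * smul y 1 = smul (x * y) 1.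
Proof.
by rewrite -smulE ?(smul_A hs) //; [|apply: (smul_closed hs)]; exact: dgroup1.
Qed.

Lemma Eplus_smul1M x a : 0 <= x -> Pos a -> Pos (smul x 1 * a).
Proof.
move=> x0 a0; rewrite -smulE; last exact: Eplus_dgroup.
exact: Eplus_smul.
Qed.

Lemma Eplus_smul1_cancel x a : 0 < x -> Pos (smul x 1 * a) -> Pos a.
Proof.
move=> x0 /(@Eplus_smul1M x^-1); rewrite mulrA smul1M mulVf ?gt_eqF //.
by rewrite (smul_1 hs dgroup1) mul1r invr_ge0; apply; exact: ltW.
Qed.

Lemma smul1_nat n : smul n%:R 1 = n%:R.
Proof.
have := smul_dyadic 0 n dgroup1.
by rewrite !expr0 mul1r.
Qed.

(** If [y < x], dividing by [x - y] would make [-1] positive, against [1 <> 0]. *)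
Lemma smul1_le x y : Pos (smul y 1 - smul x 1) -> x <= y.
Proof.
move=> xy; rewrite leNgt; apply/negP => yx.
have G1 := dgroup1.
have /Eplus_smul1_cancel : Pos (smul (x - y) 1 * (- 1)).
  by rewrite mulrN1 smulBl // opprB.
rewrite subr_gt0 => /(_ yx) /(ering_pointed hE Eplus1).
by apply/eqP; exact: oner_neq0.
Qed.

(** * The spectral resolution *)

Section Spectrum.
Context (g : R) (Gg : G g).
Local Notation L := (spec_lower E smul g).
Local Notation U := (spec_upper E smul g).
Local Notation t := (smul^~ 1).
Local Notation p := (spec_resolution E smul g).
Local Notation d := (eigenproj E smul g).

Let G1 := dgroup1.
Let Gt x : G (t x) := smul_closed hs x G1.
Let Gu x : G (g - t x) := dgroupB Gg (Gt x).

Lemma has_sup_spec_lower : has_sup [set x | leG E (t x) g].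
Proof.
have [n ng] := dgroup_order_unit Gg.
have [m mg] := dgroup_order_unit (dgroupN Gg).
split.
  by exists (- m%:R); rewrite /= /leG smulNl // smul1_nat opprK addrC -[g]opprK.
exists n%:R => x /= xg; apply: smul1_le; rewrite smul1_nat.
exact: Eplus_trans xg ng.
Qed.

Lemma has_inf_spec_upper : has_inf [set x | leG E g (t x)].
Proof.
have [n ng] := dgroup_order_unit Gg.
have [m mg] := dgroup_order_unit (dgroupN Gg).
split; first by exists n%:R; rewrite /= /leG smul1_nat.
exists (- m%:R) => x /= gx; apply: smul1_le; rewrite smulNl // smul1_nat.
by apply: Eplus_trans gx; rewrite opprK addrC -[g]opprK.
Qed.

Lemma comm_shift h x : G h -> GRing.comm h g -> GRing.comm h (g - t x).
Proof. by move=> Gh hg; apply: commrB => //; exact: smul1_central. Qed.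

(** The positive-part decomposition of [g - t x], read with [q = 1 - p x]. The last clause is the
    only trace of the carrier: the factor [g - t x] may be cancelled next to [1 - p x]. *)
Lemma spec_resolutionP x :
  [/\ projG E (p x), forall h, G h -> GRing.comm h g -> GRing.comm h (p x),
      Pos ((1 - p x) * (g - t x)), Pos (- (p x * (g - t x)))
    & forall h, G h -> (1 - p x) * (g - t x) * h = 0 -> (1 - p x) * h = 0].
Proof.
have [a0 _ _] := absGP (Gu x).
have := carrier_pos_partP (Gu x).
rewrite /spec_resolution /pos_part smul_half; last first.
  by apply: dgroupD => //; exact: Eplus_dgroup.
set q := carrier E _ => -[hq cq qu1 qu2 ann].
have -> : 1 - (1 - q) = q by rewrite opprB addrC subrK.
split=> // [|h Gh hg]; first exact: projGC.
by apply: commrB; [exact: commr1|exact/cq/comm_shift].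
Qed.

Lemma eigenprojP x :
  [/\ projG E (d x), forall h, G h -> GRing.comm h g -> GRing.comm h (d x)
    & (g - t x) * d x = 0].
Proof.
have [hq ann cq] := carrierP (Gu x); rewrite /eigenproj.
split=> [|h Gh hg|]; first exact: projGC.
  by apply: commrB; [exact: commr1|exact/cq/comm_shift].
apply/ann; first exact/projG_dgroup/projGC.
by rewrite mulrBr mulr1 projG_mul // subrr.
Qed.

Let Gp x : G (p x). Proof. by have [/projG_dgroup] := spec_resolutionP x. Qed.
Let Gd x : G (d x). Proof. by have [/projG_dgroup] := eigenprojP x. Qed.

Lemma spec_resolution_comm x : GRing.comm g (p x).
Proof. by have [_ cp _ _ _] := spec_resolutionP x; exact: cp. Qed.

Lemma eigenproj_comm x : GRing.comm g (d x).
Proof. by have [_ cp _] := eigenprojP x; exact: cp. Qed.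

Lemma spec_resolution_comm2 x y : GRing.comm (p x) (p y).
Proof.
have [_ cp _ _ _] := spec_resolutionP y; apply: cp => //.
exact/commr_sym/spec_resolution_comm.
Qed.

Lemma eigenproj_resolution_comm x y : GRing.comm (d x) (p y).
Proof.
have [_ cp _ _ _] := spec_resolutionP y; apply: cp => //.
exact/commr_sym/eigenproj_comm.
Qed.

(** Monotonicity in multiplicative form: the order, the difference formula and the meet in clause
    (iii) all follow from it. *)
Lemma spec_resolution_mul x y : x <= y -> p x * p y = p x.
Proof.
move=> xy.
have [hx _ _ ux _] := spec_resolutionP x.
have [hy _ uy _ ann] := spec_resolutionP y.
have pxy := spec_resolution_comm2 x y.
set q := 1 - p y in uy ann; have hq : projG E q by exact: projGC.
have qp : GRing.comm q (p x).
  by apply/commr_sym/commrB; [exact: commr1|].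
have pu z w : GRing.comm (p z) (g - t w).
  by apply: comm_shift => //; exact/commr_sym/spec_resolution_comm.
have qu z : GRing.comm q (g - t z).
  by apply/commr_sym/commrB; [exact: commr1|exact/commr_sym/pu].
have lo : Pos (q * - (p x * (g - t x))).
  apply: EplusM => //; first exact: Eplus_projG.
  by apply: commrN; apply: commrM.
have hi : Pos (q * (g - t y) * p x).
  apply: EplusM => //; first exact: Eplus_projG.
  by apply/commr_sym/commrM; [exact/commr_sym|exact: pu].
(* [r = (1 - p y) p x] satisfies [y r <= r g <= x r], although [x <= y]. *)
have gap : Pos (t (y - x) * (q * p x)).
  apply: Eplus_smul1M; first by rewrite subr_ge0.
  by apply: EplusM => //; exact: Eplus_projG.
have : q * (g - t y) * p x = 0.
  apply: (ering_pointed hE) => //.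
  have -> : - (q * (g - t y) * p x) =
      q * - (p x * (g - t x)) + t (y - x) * (q * p x).
    rewrite smulBl // -[q * (g - t y) * p x]mulrA -(pu x y).
    have Gqp : G (q * p x) by apply: dgroupM => //; exact: projG_dgroup.
    rewrite -smulBl // -(smul1_central (y - x) Gqp) smulBl //.
    by ncring.
  exact: EplusD.
(* For [x = y] the gap is zero and yields no bound on [r] itself; the carrier property cancels
   [g - t y] and gives [r = 0] in all cases. *)
move=> /ann -/(_ (Gp x)); rewrite mulrBl mul1r => /subr0_eq.
by rewrite pxy => <-.
Qed.

(** [(1 - p x) (g - t x)] is positive by construction and negative by hypothesis, hence zero;
    cancelling [g - t x] leaves [1 - p x = 0]. *)
Lemma spec_resolution_eq1 x : leG E g (t x) -> p x = 1.
Proof.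
move=> gx; have [hp _ u _ ann] := spec_resolutionP x.
have hq := projGC hp.
have uq : (1 - p x) * (g - t x) = 0.
  apply: (ering_pointed hE) => //; rewrite -mulrN (opprB g).
  apply: EplusM => //; first exact: Eplus_projG.
  rewrite -(opprB g); apply: commrN; apply: commr_sym.
  apply: commrB; first exact: commr1.
  by apply/commr_sym/comm_shift => //; exact/commr_sym/spec_resolution_comm.
have := ann 1 G1; rewrite uq mul0r mulr1 => /(_ erefl) /subr0_eq.
exact: esym.
Qed.

Lemma spec_resolution_eq1_le x : p x = 1 -> leG E g (t x).
Proof.
move=> p1; have [_ _ _ u _] := spec_resolutionP x.
by move: u; rewrite p1 mul1r opprB.
Qed.

Lemma spec_resolution_eq0_le x : p x = 0 -> leG E (t x) g.
Proof.
move=> p0; have [_ _ u _ _] := spec_resolutionP x.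
by move: u; rewrite p0 subr0 mul1r.
Qed.

(** On [p x] the element [g] is at most [x] and at least [y], so [(y - x) p x <= 0]. The gap must be
    strict: an eigenprojection at the lower bound lies below the resolution there. *)
Lemma spec_resolution_eq0 x y : x < y -> leG E (t y) g -> p x = 0.
Proof.
move=> xy yg; have [hp _ _ u _] := spec_resolutionP x.
have p0 := Eplus_projG hp; apply: (ering_pointed hE) => //.
apply: (@Eplus_smul1_cancel (y - x)); first by rewrite subr_gt0.
have : Pos (p x * (g - t y)).
  apply: EplusM => //; apply: comm_shift => //.
  exact/commr_sym/spec_resolution_comm.
move=> /(EplusD u); congr Pos.
rewrite mulrN -(smul1_central (y - x) (Gp x)) smulBl //.
by ncring.
Qed.

(** * Spectral bounds and eigenprojections *)

Lemma spec_upper_le x : leG E g (t x) -> U <= x.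
Proof. by move=> gx; apply: ge_inf => //; exact: has_inf_spec_upper.2. Qed.

Lemma spec_lower_ge x : leG E (t x) g -> x <= L.
Proof. by move=> xg; apply: ub_le_sup => //; exact: has_sup_spec_lower.2. Qed.

Lemma spec_upper_lt x : U < x -> p x = 1.
Proof.
move=> Ux; have [y gy yx] := inf_lt has_inf_spec_upper.1 Ux.
apply: spec_resolution_eq1; apply: Eplus_trans gy _.
by apply: smul_le; [exact: ltW|exact: Eplus1].
Qed.

Lemma spec_lower_gt x : x < L -> p x = 0.
Proof.
move=> xL; have [y yg xy] := sup_gt has_sup_spec_lower.1 xL.
exact: spec_resolution_eq0 xy yg.
Qed.

(** [g - t x] kills [d x], so cancellation next to [1 - p x] gives [(1 - p x) d x = 0]. *)
Lemma eigenproj_le_resolution x : leG E (d x) (p x).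
Proof.
have [hp _ _ _ ann] := spec_resolutionP x; have [hd _ ud] := eigenprojP x.
have pd : p x * d x = d x.
  apply/esym/subr0_eq; rewrite -[X in X - _]mul1r -mulrBl.
  by apply: ann => //; rewrite -mulrA ud mulr0.
by apply: projG_le; rewrite // (eigenproj_resolution_comm x x).
Qed.

(** On [d y * p x] the element [g] acts as [y] and is at most [x < y], which forces this product to
    vanish. *)
Lemma resolution_le_eigenprojC x y : x < y -> leG E (p x) (1 - d y).
Proof.
move=> xy; have [hp _ _ u _] := spec_resolutionP x.
have [hd _ ud] := eigenprojP y.
have dp := eigenproj_resolution_comm y x.
have dp0 : Pos (d y * p x) by apply: EplusM => //; exact: Eplus_projG.
have z : d y * p x = 0.
  apply: (ering_pointed hE) => //.
  apply: (@Eplus_smul1_cancel (y - x)); first by rewrite subr_gt0.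
  have cu w : GRing.comm (d y) (g - t w).
    by apply: comm_shift => //; exact/commr_sym/eigenproj_comm.
  have : Pos (d y * - (p x * (g - t x))).
    apply: EplusM => //; first exact: Eplus_projG.
    by apply: commrN; apply: commrM.
  congr Pos.
  rewrite mulrN mulrN -(smul1_central (y - x) (Eplus_dgroup dp0)); congr (- _).
  rewrite mulrA dp -[LHS]subr0 -(mulr0 (p x)) -ud -(cu y) smulBl //.
  by ncring.
apply: projG_le => //; first exact: projGC.
  by rewrite mulrBr mulr1 -dp z subr0.
by rewrite mulrBl mul1r z subr0.
Qed.

(** The set contains every [x < L] and nothing above [L]; whether it contains [L] is left open, so a
    midpoint argument compares the suprema. [has_sup] is included because [sup] has a default value
    on other sets. *)
Lemma spec_lower_sup :
  has_sup [set x | p x = 0] /\ L = sup [set x | p x = 0].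
Proof.
have ubL : ubound [set x | p x = 0] L.
  by move=> x /= /spec_resolution_eq0_le; exact: spec_lower_ge.
have ne : [set x | p x = 0] !=set0.
  by exists (L - 1); apply: spec_lower_gt; rewrite ltrBlDr ltrDl.
have hsup : has_sup [set x | p x = 0] by split=> //; exists L.
split=> //; apply/eqP; rewrite eq_le ge_sup // andbT leNgt; apply/negP => lt.
have [lty yL] := (midf_lt lt).
have := ub_le_sup hsup.2 (spec_lower_gt yL).
by rewrite leNgt lty.
Qed.

Lemma spec_upper_inf :
  has_inf [set x | p x = 1] /\ U = inf [set x | p x = 1].
Proof.
have lbU : lbound [set x | p x = 1] U.
  by move=> x /= /spec_resolution_eq1_le; exact: spec_upper_le.
have ne : [set x | p x = 1] !=set0.
  by exists (U + 1); apply: spec_upper_lt; rewrite ltrDl.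
have hinf : has_inf [set x | p x = 1] by split=> //; exists U.
split=> //; apply/eqP; rewrite eq_le lb_le_inf //= leNgt; apply/negP => lt.
have [Uy ylt] := (midf_lt lt).
have := ge_inf hinf.2 (spec_upper_lt Uy).
by rewrite leNgt ylt.
Qed.

(** * Scalar multiples of projections and compressions of [g] *)

Lemma smul_spec_resolution x :
  p x * g - smul x (p x) = p x * (g - t x) /\
  (1 - p x) * g - smul x (1 - p x) = (1 - p x) * (g - t x).
Proof.
have Gq : G (1 - p x) by exact: dgroupB.
by split; rewrite smulE // -(smul1_central x) // mulrBr.
Qed.

Lemma smul_compress x q : projG E q ->
  q * g * q - smul x q = q * (g - t x) * q.
Proof.
move=> hq; have Gq := projG_dgroup hq.
by rewrite smulE // -[q in t x * q](projG_mul hq) mulrA -(smul1_central x Gq);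
  ncring.
Qed.

(** Since [q = q (1 - p x)], the difference is the compression by [q] of the positive element
    [(1 - p x) (g - t x)]. *)
Lemma compress_ge q x : projG E q -> Pos (1 - p x - q) ->
  leG E (smul x q) (q * g * q).
Proof.
move=> hq qx; have [hp _ u _ _] := spec_resolutionP x.
have [qp _] := projG_le_mul hq (projGC hp) qx.
rewrite /leG smul_compress // -{1}qp -(mulrA q).
exact: projG_compress.
Qed.

Lemma compress_le q x : projG E q -> Pos (p x - q) ->
  leG E (q * g * q) (smul x q).
Proof.
move=> hq qx; have [hp _ _ u _] := spec_resolutionP x.
have [qp _] := projG_le_mul hq hp qx.
rewrite /leG -opprB smul_compress // -{1}qp -(mulrA q) -mulNr -mulrN.
exact: projG_compress.
Qed.

End Spectrum.
End ScalarMultiplication.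

End AHAlgebra.
End Half.
End ERing.

Theorem theorem7p6 (K : realType) (R : nzRingType) (E : set R)
    (hAH : is_AH_algebra E)
    (smul : K -> R -> R) (hsmul : is_scalar_mul E smul)
    (g : R) (hg : dgroup E g) :
  let L := spec_lower E smul g in
  let U := spec_upper E smul g in
  let p := spec_resolution E smul g in
  let d := eigenproj E smul g in
  (* (i) *)
  (forall l : K,
     [/\ projG E (p l), bicommutant E [set g] (p l),
         projG E (d l), bicommutant E [set g] (d l)
       & d l * p l = p l * d l]) /\
  (* (ii) *)
  (forall l : K,
     leG E (p l * g - smul l (p l)) 0 /\
     leG E 0 ((1 - p l) * g - smul l (1 - p l))) /\
  (* (iii) *)
  (forall l m : K, l <= m ->
     leG E (p l) (p m) /\ is_meet_proj E (p m) (1 - p l) (p m - p l)) /\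
  (* (iv) *)
  (forall l m : K, l < m -> leG E (d l) (p l) /\ leG E (p l) (1 - d m)) /\
  (* (v) *)
  (forall l : K, (U < l -> p l = 1) /\ (l < U -> ltG E (p l) 1)) /\
  (* (vi) *)
  (forall l : K, (l < L -> p l = 0) /\ (L < l -> ltG E 0 (p l))) /\
  (* (vii) *)
  ((has_sup [set l : K | p l = 0] /\ L = sup [set l : K | p l = 0]) /\
   (has_inf [set l : K | p l = 1] /\ U = inf [set l : K | p l = 1])) /\
  (* (viii) *)
  (forall (l m : K) (q : R), l <= m -> projG E q -> leG E q (p m - p l) ->
     leG E (smul l q) (q * g * q) /\ leG E (q * g * q) (smul m q)).
Proof.
have [hE [c Ec c2] QA CV] := hAH.
move=> L U p d.
have resP := spec_resolutionP hE Ec c2 QA CV hsmul hg; rewrite -/p in resP.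
have eigP := eigenprojP hE Ec c2 QA CV hsmul hg; rewrite -/d in eigP.
have hp l : projG E (p l) by case: (resP l).
have hd l : projG E (d l) by case: (eigP l).
have bic q : projG E q ->
    (forall h, dgroup E h -> GRing.comm h g -> GRing.comm h q) ->
    bicommutant E [set g] q.
  move=> hq cq; split; first exact: projG_dgroup hq.
  by move=> h [Gh hgc]; apply/commr_sym/cq => //; exact: hgc.
have pmul := spec_resolution_mul hE Ec c2 QA CV hsmul hg; rewrite -/p in pmul.
have pcomm l m : GRing.comm (p l) (p m).
  exact: (spec_resolution_comm2 hE Ec c2 QA CV hsmul hg).
have ple l m : l <= m -> leG E (p l) (p m).
  by move=> lm; apply: projG_le; rewrite // -?(pcomm l m) pmul.
have le1 q : projG E q -> leG E q 1.
  by move=> hq; apply: (Eplus_projG hE); exact: projGC.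
(* As a product of commuting projections, the difference is their meet. *)
have diffE l m : l <= m -> p m - p l = p m * (1 - p l).
  by move=> lm; rewrite mulrBr mulr1 -(pcomm l m) pmul.
split; [|split; [|split; [|split; [|split; [|split; [|split]]]]]].
- move=> l; have [_ cp _ _ _] := resP l; have [_ cd _] := eigP l.
  split=> //; try exact: bic.
  exact: (eigenproj_resolution_comm hE Ec c2 QA CV hsmul hg).
- move=> l; have [_ _ u v _] := resP l.
  have [e1 e2] := smul_spec_resolution hE Ec c2 QA CV hsmul hg l.
  by rewrite /leG e1 e2 sub0r subr0.
- move=> l m lm; split; first exact: ple.
  rewrite diffE //; apply: projG_meetM => //; first exact: projGC.
  by apply: commrB; [exact: commr1|].
- move=> l m lm; split.
    exact: (eigenproj_le_resolution hE Ec c2 QA CV hsmul hg).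
  exact: (resolution_le_eigenprojC hE Ec c2 QA CV hsmul hg lm).
- move=> l; split=> [|lU]; first exact: (spec_upper_lt hE Ec c2 QA CV hsmul hg).
  split; first exact: le1.
  move=> /(spec_resolution_eq1_le hE Ec c2 QA CV hsmul hg).
  move=> /(spec_upper_le hE Ec c2 CV hsmul hg).
  by rewrite leNgt lU.
- move=> l; split=> [|Ll]; first exact: (spec_lower_gt hE Ec c2 QA CV hsmul hg).
  split; first by rewrite /leG subr0; exact: Eplus_projG.
  move=> /esym /(spec_resolution_eq0_le hE Ec c2 QA CV hsmul hg).
  move=> /(spec_lower_ge hE Ec c2 CV hsmul hg).
  by rewrite leNgt Ll.
- split; first exact: (spec_lower_sup hE Ec c2 QA CV hsmul hg).
  exact: (spec_upper_inf hE Ec c2 QA CV hsmul hg).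
move=> l m q lm hq qlm; split.
  (* [p m - p l] lies below [1 - p l], with difference [1 - p m]; for the other bound it lies below
     [p m], with difference [p l]. *)
  apply: (compress_ge hE Ec c2 QA CV hsmul hg) => //.
  apply: Eplus_trans qlm _.
  by rewrite (_ : _ - _ = 1 - p m); [exact: le1|ncring].
apply: (compress_le hE Ec c2 QA CV hsmul hg) => //.
apply: Eplus_trans qlm _.
by rewrite (_ : _ - _ = p l); [exact: Eplus_projG|ncring].
Qed.
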